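(* Let $\mathcal M$ be an instance of the MIM problem on the graph $G=(V,E)$ with $n=|V|$ and arbitrary activation functions, and let $\mathcal R$ be a random RR-tuple. For each $S\subseteq V$, \[\mathbb E[n\cdot\underline g(S,\mathcal R)]\ \le\ \mathbb E[n\cdot g(S,\mathcal R)]\ =\ f(S)\ \le\ \mathbb E[n\cdot\overline g(S,\mathcal R)].\]
   Context: Independent Multi-Cascade (IMC) model. A social network is a finite directed graph $G=(V,E)$ with $n=|V|$, $m=|E|$; each edge $(u,v)$ has a propagation probability $p_{(u,v)}\in(0,1]$. $C$ is a finite set of cascades; each $c\in C$ has a seed set $\tau(c)\subseteq V$. Each node is either inactive or $c$-active for exactly one $c\in C$, and once active it never changes state. Let $\pi_t(v)$ be the state of $v$ at step $t$. Each node $v$ has an activation function $F_v:2^{V\times C}\to C$ (needed only on the inputs that can arise) such that: (a) if $v$ is a seed of exactly the cascades in a nonempty $C'\subseteq C$, then at step 0 $v$ becomes $F_v(O)$-active with $O=\{(v,c):c\in C'\}$, and $F_v(O)\in C'$; (b) if $v$ is for the first time successfully activated at step $t$, by exactly the set $A$ of in-neighbors, then $v$ becomes $F_v(O)$-active with $O=\{(u,\pi_{t-1}(u)):u\in A\}$, and $F_v(O)\in\{\pi_{t-1}(u):u\in A\}$. Diffusion: at step 0 seeds are activated by (a), other nodes are inactive. At step $t\ge1$ each node $u$ activated at step $t-1$ makes one independent attempt to activate each inactive out-neighbor $v$, succeeding with probability $p_{(u,v)}$; nodes with at least one success are activated by (b). The process ends when no further activation is possible. MIM instance $\mathcal M$: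 a finite directed graph $G=(V,E)$ with propagation probabilities $p_{(u,v)}\in(0,1]$ on its edges, existing cascades $C_e=\{c_1,\dots,c_L\}$ with known seed sets $\tau(c_i)$, a new cascade $c_{new}$, $C=C_e\cup\{c_{new}\}$, activation functions $F_v$ over $C$, a candidate set $V_c\subseteq V$, and $k\in\mathbb{Z}^+$ (the last two play no role here). For $S\subseteq V$, $f(S)$ is the expected number of $c_{new}$-active nodes at the end when $S$ is the seed set of $c_{new}$. RR-tuple of $v$ (random). Let $\tau^*=\bigcup_{c\in C_e}\tau(c)$. Start with $V(G_v)=\{v\}$, $E(G_v)=\emptyset$, $V_t=\{v\}$, $\overline S_v=\underline S_v=\emptyset$, and repeat: (i) if $V_t=\emptyset$, return; (ii) if $V_t\cap\tau^*\ne\emptyset$, set $\overline S_v\leftarrow\overline S_v\cup V_t$ and return; (iii) otherwise add $V_t$ to both $\overline S_v$ and $\underline S_v$, let $V_r=V\setminus V(G_v)$ and $E^*=\{(u_1,u_2)\in E:u_1\in V_r,u_2\in V_t\}$, reset $V_t=\emptyset$, and for each $(u_1,u_2)\in E^*$, independently with probability $p_{(u_1,u_2)}$, add $u_1$ to $V_t$ and to $V(G_v)$ and add $(u_1,u_2)$ to $E(G_v)$. The output is $R_v=(G_v,\underline S_v,\overline S_v)$. An RR-tuple $\mathcal R$ is obtained by choosing $v\in V$ uniformly at random and then generating an RR-tuple of $v$. For an RR-tuple $R_v$, let $\mathcal M_{R_v}$ be the MIM instance on $G_v$ where each $c\in C_e$ has seed set $V(G_v)\cap\tau(c)$, all edge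 probabilities are 1, and activation functions are as in $\mathcal M$. Define $g(S,R_v)=1$ if $v$ is $c_{new}$-active in $\mathcal M_{R_v}$ when $c_{new}$ has seed set $S$ (i.e. $S\cap V(G_v)$), else $0$; $\overline g(S,R_v)=1$ if $S\cap\overline S_v\ne\emptyset$, else $0$; $\underline g(S,R_v)=1$ if $S\cap\underline S_v\ne\emptyset$, else $0$. *)

(* Defs.v *)
From HB Require Import structures.
From mathcomp Require Import all_boot all_order all_algebra.
Set Implicit Arguments.
Unset Strict Implicit.
Unset Printing Implicit Defensive.
Import Order.TTheory GRing.Theory Num.Theory.
Local Open Scope ring_scope.

Section FiniteLaws.
Variable R : realFieldType.

(* The law of a random element of a finite type, as its mass function. *)
Definition law (T : finType) := {ffun T -> R}.

Definition dirac_law (T : finType) (x : T) : law T := [ffun y => (y == x)%:R].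

Definition uniform_law (T : finType) (A : {set T}) : law T :=
  [ffun x => if x \in A then #|A|%:R^-1 else 0].

(* Draw [x] from [mu], then draw from [k x]. *)
Definition bind_law (T T' : finType) (mu : law T) (k : T -> law T') : law T' :=
  [ffun y => \sum_x mu x * k x y].

(* The random set of successes of independent trials, one for each [e] in [D],
   trial [e] succeeding with probability [p e]. *)
Definition trials (T : finType) (p : T -> R) (D : {set T}) : law {set T} :=
  [ffun A : {set T} => if A \subset D
    then (\prod_(e in A) p e) * \prod_(e in D :\: A) (1 - p e) else 0].

Definition expect (T : finType) (mu : law T) (X : T -> R) : R :=
  \sum_x mu x * X x.

Definition pr (T : finType) (mu : law T) (P : pred T) : R :=
  \sum_(x | P x) mu x.

Lemma trials_sum1 (T : finType) (p : T -> R) (D : {set T}) :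
  \sum_A trials p D A = 1.
Proof.
have h : \prod_(e in D) (p e + (1 - p e)) = 1 :> R.
  by apply: big1 => e _; rewrite addrC subrK.
rewrite -[RHS]h [RHS]big_mkcond /=.
rewrite [RHS](eq_bigr (fun e => (if e \in D then p e else 0)
                         + (if e \in D then 1 - p e else 1))); last first.
  by move=> e _; case: ifP => _; rewrite ?add0r.
rewrite bigA_distr /=; apply: eq_bigr => A _; rewrite ffunE.
have [sAD|] := boolP (A \subset D); last first.
  case/subsetPn => e eA eD.
  by rewrite (bigD1 e) //= eA (negPf eD) mul0r.
rewrite [RHS](bigID (mem A)) /=; congr (_ * _).
  by apply: eq_big => // e eA; rewrite eA (subsetP sAD).
rewrite [RHS]big_mkcond [LHS]big_mkcond; apply: eq_bigr => e _.
by rewrite !inE; case: (e \in A); case: (e \in D).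
Qed.

Lemma bind_trials_eq (T T' : finType) (p : T -> R) (D : {set T})
    (k k' : {set T} -> law T') :
  (forall A : {set T}, A \subset D -> k A = k' A) ->
  bind_law (trials p D) k = bind_law (trials p D) k'.
Proof.
move=> h; apply/ffunP => y; rewrite !ffunE; apply: eq_bigr => A _.
by rewrite !ffunE; case: ifP => [/h -> //|_]; rewrite !mul0r.
Qed.

End FiniteLaws.

(* [Some c] is the existing cascade [c]; [None] is the new cascade. *)
Definition cascade (Ce : finType) : finType := option Ce.
Definition c_new {Ce : finType} : cascade Ce := None.

(* The nodes form a subset of an ambient finite type [U], so that a random
   subgraph of a network again carries an instance over the same [U] and the
   activation functions can be shared. *)
Record mim (R : realFieldType) (U Ce : finType) := MIM {
  nodes : {set U};
  edges : {set U * U};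
  eprob : U * U -> R;
  eseed : Ce -> {set U};
  actf  : U -> {set U * cascade Ce} -> cascade Ce
}.

(* The activation functions are constrained only on the two kinds of inputs
   that can arise: simultaneous seeding of [v], and simultaneous successful
   activation of [v] by a set of active in-neighbours. *)
Definition actf_valid (R : realFieldType) (U Ce : finType) (M : mim R U Ce) :
    Prop :=
  forall v, v \in nodes M ->
    (forall C' : {set cascade Ce}, C' != set0 ->
       actf M v [set (v, c) | c in C'] \in C') /\
    (forall (A : {set U}) (pi : U -> cascade Ce), A != set0 ->
       (forall u, u \in A -> (u, v) \in edges M) ->
       actf M v [set (u, pi u) | u in A] \in [set pi u | u in A]).

Definition mim_valid (R : realFieldType) (U Ce : finType) (M : mim R U Ce) :
    Prop :=
  [/\ forall e, e \in edges M -> (e.1 \in nodes M) && (e.2 \in nodes M),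
      forall e, e \in edges M -> 0 < eprob M e <= 1,
      forall c, eseed M c \subset nodes M
    & actf_valid M].

Section Diffusion.
Variables (R : realFieldType) (U Ce : finType) (M : mim R U Ce).

(* [pi v = None] when [v] is inactive, [pi v = Some c] when it is [c]-active. *)
Definition config : finType := {ffun U -> option (cascade Ce)}.

Definition seed_set (S : {set U}) (c : cascade Ce) : {set U} :=
  if c is Some c' then eseed M c' else S.

Definition cascades_at (S : {set U}) (v : U) : {set cascade Ce} :=
  [set c | v \in seed_set S c].

Definition init_config (S : {set U}) : config :=
  [ffun v => if cascades_at S v == set0 then None
             else Some (actf M v [set (v, c) | c in cascades_at S v])].

Definition init_fresh (S : {set U}) : {set U} :=
  [set v | cascades_at S v != set0].

(* The edges along which an activation is attempted, [N] being the set of nodes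
   activated at the previous step. *)
Definition attempts (pi : config) (N : {set U}) : {set U * U} :=
  [set e in edges M | (e.1 \in N) && (pi e.2 == None)].

(* The configuration after one step, [A] being the set of edges along which the
   attempts succeeded. *)
Definition next_config (pi : config) (A : {set U * U}) : config :=
  [ffun v => if [exists u, (u, v) \in A]
             then Some (actf M v [set uc : U * cascade Ce |
                         ((uc.1, v) \in A) && (pi uc.1 == Some uc.2)])
             else pi v].

Definition next_fresh (A : {set U * U}) : {set U} := [set e.2 | e in A].

Fixpoint diffuse (steps : nat) (pi : config) (N : {set U}) : law R config :=
  if steps is k.+1 then
    if attempts pi N == set0 then dirac_law R pi
    else bind_law (trials (eprob M) (attempts pi N))
           (fun A => diffuse k (next_config pi A) (next_fresh A))
  else dirac_law R pi.

(* The law of the configuration at the end of the process. Every step that is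
   neither the last one nor idle activates a further node, so [#|nodes M|]
   steps always suffice: see [diffuse_stable]. *)
Definition final_law (S : {set U}) : law R config :=
  diffuse #|nodes M| (init_config S) (init_fresh S).

Definition spread (S : {set U}) : R :=
  expect (final_law S)
    (fun pi => #|[set v in nodes M | pi v == Some c_new]|%:R).

Lemma diffuse_idle k pi : diffuse k pi set0 = dirac_law R pi.
Proof.
case: k => //= k; case: eqP => // -[]; apply/setP => e.
by rewrite !inE /= andbF.
Qed.

Lemma diffuse_stableS k (pi : config) N :
  (forall e, e \in edges M -> (e.1 \in nodes M) && (e.2 \in nodes M)) ->
  (#|[set v in nodes M | pi v == None]| <= k)%N ->
  diffuse k.+1 pi N = diffuse k pi N.
Proof.
move=> hE; elim: k pi N => [|k IHk] pi N.
  rewrite leqn0 cards_eq0 => /eqP h0.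
  suff h : attempts pi N = set0 by rewrite /= h eqxx.
  apply/setP => e; rewrite !inE; apply/negP => /and3P[/hE/andP[_ e2] _ pe].
  by have := in_set0 e.2; rewrite -h0 inE e2 pe.
move=> hk; rewrite [LHS]/= [RHS]/=; case: ifP => // _.
apply: bind_trials_eq => A sA; have [->|[e eA]] := set_0Vmem A.
  rewrite /next_fresh imset0; case: k {IHk hk} => [|k].
    by rewrite -/(diffuse 1 _ _) diffuse_idle.
  by rewrite -/(diffuse k.+2 _ _) !diffuse_idle.
apply: IHk; rewrite -ltnS; apply: leq_trans hk; apply: proper_card.
have /[!inE] /and3P[/hE/andP[_ e2] _ pe] := subsetP sA _ eA.
apply/properP; split; last first.
  exists e.2; rewrite !inE ?e2 ?pe // ffunE ifT // ?andbF //.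
  by apply/existsP; exists e.1; rewrite -surjective_pairing.
apply/subsetP => v; rewrite !inE ffunE => /andP[-> /=].
by case: ifP.
Qed.

Lemma diffuse_stable S j :
  (forall e, e \in edges M -> (e.1 \in nodes M) && (e.2 \in nodes M)) ->
  diffuse (#|nodes M| + j) (init_config S) (init_fresh S) = final_law S.
Proof.
move=> hE; elim: j => [|j IHj]; first by rewrite addn0.
rewrite addnS diffuse_stableS //; apply: leq_trans (leq_addr _ _).
by apply/subset_leq_card/subsetP => v; rewrite inE => /andP[].
Qed.

End Diffusion.

(* [rr_under] and [rr_over] are the sets written with a lower and an upper bar. *)
Record rr_tuple (U : finType) := RRTuple {
  rr_root  : U;
  rr_nodes : {set U};
  rr_edges : {set U * U};
  rr_under : {set U};
  rr_over  : {set U}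
}.

Section RRTupleFinite.
Variable U : finType.

Definition rr_enc (r : rr_tuple U) :=
  (rr_root r, rr_nodes r, rr_edges r, rr_under r, rr_over r).
Definition rr_dec (x : U * {set U} * {set U * U} * {set U} * {set U}) :=
  let: (v, W, E, Sl, Su) := x in RRTuple v W E Sl Su.

Lemma rr_encK : cancel rr_enc rr_dec.
Proof. by case. Qed.

HB.instance Definition _ := Finite.copy (rr_tuple U) (can_type rr_encK).

End RRTupleFinite.

Section RRTuples.
Variables (R : realFieldType) (U Ce : finType) (M : mim R U Ce).

Definition existing_seeds : {set U} := \bigcup_(c : Ce) eseed M c.

Definition rr_frontier (r : rr_tuple U) (Vt : {set U}) : {set U * U} :=
  [set e in edges M | (e.1 \in nodes M :\: rr_nodes r) && (e.2 \in Vt)].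

Fixpoint rr_loop (passes : nat) (r : rr_tuple U) (Vt : {set U}) :
    law R (rr_tuple U) :=
  if passes is k.+1 then
    if Vt == set0 then dirac_law R r
    else if Vt :&: existing_seeds != set0 then
      dirac_law R (RRTuple (rr_root r) (rr_nodes r) (rr_edges r)
                     (rr_under r) (rr_over r :|: Vt))
    else
      bind_law (trials (eprob M) (rr_frontier r Vt)) (fun A =>
        let Vt' := [set e.1 | e in A] in
        rr_loop k (RRTuple (rr_root r) (rr_nodes r :|: Vt') (rr_edges r :|: A)
                     (rr_under r :|: Vt) (rr_over r :|: Vt)) Vt')
  else dirac_law R r.

(* Every pass with nonempty [Vt] other than the first one has just enlarged the
   node set, so the loop returns within [#|nodes M|.+1] passes: see
   [rr_loop_stable]. *)
Definition rr_law_of (v : U) : law R (rr_tuple U) :=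
  rr_loop #|nodes M|.+1 (RRTuple v [set v] set0 set0 set0) [set v].

Lemma rr_loop_set0 k r : rr_loop k r set0 = dirac_law R r.
Proof. by case: k => //= k; rewrite eqxx. Qed.

Lemma rr_loop_stableS k r Vt :
  (#|nodes M :\: rr_nodes r| < k)%N -> rr_loop k.+1 r Vt = rr_loop k r Vt.
Proof.
elim: k r Vt => // k IHk r Vt hk; rewrite [LHS]/= [RHS]/=.
case: ifP => // _; case: ifP => // _.
apply: bind_trials_eq => A sA; have [->|[e eA]] := set_0Vmem A.
  by rewrite imset0 rr_loop_set0 eqxx.
apply: IHk; rewrite -ltnS; apply: leq_trans hk; rewrite ltnS.
apply: proper_card; have /[!inE] /and3P[_ /andP[e1r e1] _] := subsetP sA _ eA.
apply/properP; split; first by apply: setDS; apply: subsetUl.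
by exists e.1; rewrite !inE ?e1 ?andbT ?e1r //= (imset_f fst eA) orbT.
Qed.

Lemma rr_loop_stable v j :
  rr_loop (#|nodes M|.+1 + j) (RRTuple v [set v] set0 set0 set0) [set v]
  = rr_law_of v.
Proof.
elim: j => [|j IHj]; first by rewrite addn0.
rewrite addnS rr_loop_stableS // addSn ltnS; apply: leq_trans (leq_addr _ _).
exact/subset_leq_card/subsetDl.
Qed.

Definition rr_law : law R (rr_tuple U) :=
  bind_law (uniform_law R (nodes M)) rr_law_of.

Definition rr_mim (r : rr_tuple U) : mim R U Ce :=
  MIM (rr_nodes r) (rr_edges r) (fun=> 1)
      (fun c => rr_nodes r :&: eseed M c) (actf M).

(* Since all edge probabilities of [rr_mim r] are 1, its final configuration is
   deterministic; "the root is active" is read as holding almost surely. *)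
Definition g (S : {set U}) (r : rr_tuple U) : R :=
  (pr (final_law (rr_mim r) (S :&: rr_nodes r))
      (fun pi => pi (rr_root r) == Some c_new) == 1)%:R.

Definition g_over (S : {set U}) (r : rr_tuple U) : R :=
  (S :&: rr_over r != set0)%:R.

Definition g_under (S : {set U}) (r : rr_tuple U) : R :=
  (S :&: rr_under r != set0)%:R.

End RRTuples.

(* Main.v *)
Require Import Defs.
From mathcomp Require Import all_boot all_order all_algebra.
Set Implicit Arguments.
Unset Strict Implicit.
Unset Printing Implicit Defensive.
Import Order.TTheory GRing.Theory Num.Theory.
Local Open Scope ring_scope.

(* Decide all the edges of the network in advance: let X be the random set of
   edges obtained by keeping each e with probability p_e. As no edge is tried
   twice, both the diffusion from S and the RR-tuple of v become deterministic
   functions of X, and it suffices to compare them for each X and v. Let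
   level j be the set of nodes at distance j to v in X, and level d the first one
   that meets the seeds of S or of an existing cascade. A node of level j <= d is
   inactive before time d - j, and at time d - j it is activated by exactly its
   in-neighbours in level j + 1 that were activated one step before. So the state
   of v depends only on the levels up to d, which the RR-tuple retains: this gives
   the equality. If level d is met by S alone, then c_new is the only cascade that
   reaches v; if S misses level d, then c_new cannot be the state of v. *)

(** * Expectations under finite laws, and splitting of independent trials *)

Section Laws.
Variable R : realFieldType.

Lemma expect_bind_dirac (T T' : finType) (mu : law R T) (f : T -> T')
    (h : T' -> R) :
  expect (bind_law mu (fun x => dirac_law R (f x))) h
  = \sum_x mu x * h (f x).
Proof.
rewrite /expect.
under eq_bigr do rewrite ffunE mulr_suml.
rewrite exchange_big /=; apply: eq_bigr => x _.
rewrite (bigD1 (f x)) //= !ffunE eqxx mulr1 big1 ?addr0 // => y /negPf ny.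
by rewrite ffunE ny mulr0 mul0r.
Qed.

Lemma expect_bind (T T' : finType) (mu : law R T) (k : T -> law R T')
    (h : T' -> R) :
  expect (bind_law mu k) h = \sum_x mu x * expect (k x) h.
Proof.
rewrite /expect.
under eq_bigr do rewrite ffunE mulr_suml.
rewrite exchange_big /=; apply: eq_bigr => x _.
by rewrite mulr_sumr; apply: eq_bigr => y _; rewrite mulrA.
Qed.

Lemma pr_dirac (T : finType) (x : T) (P : pred T) :
  pr (dirac_law R x) P = (P x)%:R.
Proof.
rewrite /pr big_mkcond (bigD1 x) //= ffunE eqxx big1 ?addr0.
  by case: (P x).
by move=> y /negPf ny; rewrite ffunE ny; case: (P y).
Qed.

Lemma trials_ge0 (T : finType) (p : T -> R) (D A : {set T}) :
  (forall e, e \in D -> 0 <= p e <= 1) -> 0 <= trials p D A.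
Proof.
move=> hp; rewrite ffunE; case: ifP => // sAD.
apply: mulr_ge0; apply: prodr_ge0 => e.
  by move=> /(subsetP sAD) /hp /andP[].
by rewrite inE subr_ge0 => /andP[_ /hp /andP[]].
Qed.

Lemma trials1 (T : finType) (D : {set T}) :
  trials (fun=> 1) D = dirac_law R D.
Proof.
apply/ffunP => A; rewrite !ffunE; case: eqVneq => [->|nAD].
  by rewrite subxx setDv big_set0 big1 // mulr1.
case: ifP => // sAD; have /subsetPn[e eD eA] : ~~ (D \subset A).
  by apply: contra nAD => sDA; rewrite eqEsubset sAD.
by rewrite [X in _ * X](bigD1 e) ?inE ?eA //= subrr mul0r mulr0.
Qed.

Lemma bind_dirac (T T' : finType) (x : T) (k : T -> law R T') :
  bind_law (dirac_law R x) k = k x.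
Proof.
apply/ffunP => y; rewrite ffunE (bigD1 x) //= ffunE eqxx mul1r big1 ?addr0 //.
by move=> z /negPf nz; rewrite ffunE nz mul0r.
Qed.

(** Subsets [X] of [E] correspond to pairs [(X :&: D, X :\: D)], and the weight of [X] is the
    product of the weights of the two parts. *)
Lemma bind_trials_split (T T' : finType) (p : T -> R) (D E : {set T})
    (k : {set T} -> law R T') :
  D \subset E ->
  bind_law (trials p E) k
  = bind_law (trials p D)
      (fun A => bind_law (trials p (E :\: D)) (fun B => k (A :|: B))).
Proof.
move=> sDE; apply/ffunP => y; rewrite !ffunE.
under [RHS]eq_bigr do rewrite [bind_law _ _ y]ffunE mulr_sumr.
rewrite pair_bigA /=.
rewrite [RHS](bigID (fun q : {set T} * {set T} =>
   (q.1 \subset D) && (q.2 \subset E :\: D))) /= [X in _ + X]big1 ?addr0; last first.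
  move=> [A B]; rewrite negb_and !ffunE /= => /orP[]/negPf->; rewrite ?mul0r //.
  by rewrite mulr0.
rewrite (reindex_onto (fun X => (X :&: D, X :\: D)) (fun q => q.1 :|: q.2)) /=;
  last first.
  move=> [A B] /= /andP[sA /subsetDP[sB dB]]; congr (_, _).
    by rewrite setIUl (setIidPl sA) (disjoint_setI0 dB) setU0.
  by rewrite setDUl (setDidPl dB) (eqP (_ : A :\: D == set0)) ?set0U // setD_eq0.
rewrite [LHS](bigID (fun X : {set T} => X \subset E)) /= [X in _ + X]big1 ?addr0;
  last by move=> X /negPf sX; rewrite ffunE sX mul0r.
apply: eq_big => [X|X sXE].
  rewrite setID eqxx andbT subsetIr /=.
  apply/idP/idP => [|/subset_trans/(_ (subsetDl E D)) sX]; first exact: setSD.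
  by rewrite -(setID X D) subUset sX (subset_trans (subsetIr _ _) sDE).
rewrite setID mulrA; congr (_ * _); rewrite !ffunE sXE subsetIr setSD //.
rewrite [in LHS](big_setID D) /= [\prod_(e in E :\: X) _](big_setID D) /=.
rewrite mulrACA; congr (_ * _ * (_ * _)).
  apply: eq_bigl => e; rewrite !inE; have := subsetP sDE e.
  by case: (e \in X) (e \in D) (e \in E) => [] [] [] // ->.
by apply: eq_bigl => e; rewrite !inE; case: (e \in X); case: (e \in D).
Qed.

End Laws.

(** * Deferred decisions for adaptive sequences of trials *)

Section Exploration.
Variables (R : realFieldType) (T Out : finType) (p : T -> R).
Variables (St : Type) (ask : St -> {set T}) (next : St -> {set T} -> St).
Variables (stop : pred St) (out out0 : St -> Out).

(** Common shape of [diffuse] and [rr_loop]: [ask s] is the batch of trials performed at [s], and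
    [out0] reads off the result when no round is left. *)
Fixpoint explore k s : law R Out :=
  if k is k'.+1 then
    if stop s then dirac_law R (out s)
    else bind_law (trials p (ask s)) (fun A => explore k' (next s A))
  else dirac_law R (out0 s).

Fixpoint reveal k s (X : {set T}) : Out :=
  if k is k'.+1 then
    if stop s then out s else reveal k' (next s (ask s :&: X)) X
  else out0 s.

(* [pot s] bounds the trials that may still be performed from [s]; the last
   hypothesis says that no trial is ever repeated. *)
Variables (inv : St -> Prop) (pot : St -> {set T}).
Hypothesis inv_next : forall s (A : {set T}),
  inv s -> A \subset ask s -> inv (next s A).
Hypothesis ask_pot : forall s, inv s -> ask s \subset pot s.
Hypothesis pot_next : forall s (A : {set T}), inv s -> A \subset ask s ->
  pot (next s A) \subset pot s :\: ask s.

Lemma reveal_local k s X Y :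
  inv s -> pot s :&: X = pot s :&: Y -> reveal k s X = reveal k s Y.
Proof.
elim: k s => //= k IHk s hs hXY; case: ifP => // _.
have -> : ask s :&: Y = ask s :&: X.
  by rewrite -(setIidPl (ask_pot hs)) -!setIA hXY.
have sA : ask s :&: X \subset ask s by exact: subsetIl.
apply: IHk; first exact: inv_next.
have /setIidPl <- := subset_trans (pot_next hs sA) (subsetDl _ _).
by rewrite -!setIA hXY.
Qed.

(** Split [E] into [ask s] and the rest: after the first round only the rest is consulted, so
    drawing new outcomes has the same law as reading them off a single sample. *)
Lemma explore_reveal k s (E : {set T}) :
  inv s -> pot s \subset E ->
  explore k s = bind_law (trials p E) (fun X => dirac_law R (reveal k s X)).
Proof.
have cst E' (nu : law R Out) : bind_law (trials p E') (fun=> nu) = nu.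
  by apply/ffunP => y; rewrite ffunE -mulr_suml trials_sum1 mul1r.
elim: k s E => [|k IHk] s E hs hE /=; first by rewrite cst.
case: ifP => [_|nstop]; first by rewrite cst.
rewrite (bind_trials_split _ _ (subset_trans (ask_pot hs) hE)).
apply: bind_trials_eq => A sA.
have sp := pot_next hs sA.
rewrite (IHk _ (E :\: ask s) (inv_next hs sA) (subset_trans sp (setSD _ hE))).
apply: bind_trials_eq => B /subsetDP[_ dB]; congr (dirac_law R _).
have -> : ask s :&: (A :|: B) = A.
  by rewrite setIUr [_ :&: B]setIC (disjoint_setI0 dB) setU0; apply/setIidPr.
(* The batch [A] may be dropped from the sample: it lies in [ask s], which the new potential
   avoids. *)
apply: reveal_local; first exact: inv_next.
rewrite setIUr [_ :&: A](_ : _ = set0) ?set0U //.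
apply/setP => e; rewrite !inE; apply/negP => /andP[/(subsetP sp)].
by rewrite inE => /andP[/negP n _] /(subsetP sA).
Qed.

End Exploration.

(** * Diffusion as a function of the live edges *)

Section Coupling.
Variables (R : realFieldType) (U Ce : finType) (M : mim R U Ce).
Hypothesis edges_nodes :
  forall e, e \in edges M -> (e.1 \in nodes M) && (e.2 \in nodes M).

Let state : Type := (config U Ce * {set U})%type.

Definition step (X : {set U * U}) (s : state) : state :=
  let A := attempts M s.1 s.2 :&: X in (next_config M s.1 A, next_fresh A).

Definition traj (X : {set U * U}) (S : {set U}) (t : nat) : state :=
  iter t (step X) (init_config M S, init_fresh M S).

Lemma next_config_set0 (pi : config U Ce) : next_config M pi set0 = pi.
Proof.
apply/ffunP => x; rewrite ffunE ifF //.
by apply/existsP => -[u]; rewrite inE.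
Qed.

Lemma step_idle X s : attempts M s.1 s.2 = set0 -> (step X s).1 = s.1.
Proof. by rewrite /step => ->; rewrite set0I /= next_config_set0. Qed.

(** [diffuse] halts when nothing can be attempted, whereas [step] is iterated further; an idle step
    keeps the configuration and empties the fresh set, so all later steps are idle too. *)
Lemma iter_step_idle X s k :
  attempts M s.1 s.2 = set0 -> (iter k (step X) s).1 = s.1.
Proof.
elim: k s => // k IHk s hs; rewrite iterSr IHk ?step_idle // /step hs set0I /=.
by apply/setP => e; rewrite !inE /next_fresh imset0 inE andbF.
Qed.

Lemma fresh_step X s u : u \in (step X s).2 -> (step X s).1 u != None.
Proof.
rewrite /step /= => /imsetP[[x y]] hxy ->; rewrite ffunE ifT //.
by apply/existsP; exists x.
Qed.

Lemma diffuse_coupling k (pi : config U Ce) (N : {set U}) :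
  (forall u, u \in N -> pi u != None) ->
  diffuse M k pi N = bind_law (trials (eprob M) (edges M))
    (fun X => dirac_law R (iter k (step X) (pi, N)).1).
Proof.
move=> hN.
pose ask (s : state) := attempts M s.1 s.2.
pose next (s : state) (A : {set U * U}) : state :=
  (next_config M s.1 A, next_fresh A).
pose stop (s : state) := ask s == set0.
pose fst_ (s : state) := s.1.
pose inv (s : state) := forall u, u \in s.2 -> s.1 u != None.
(* A source that has made its attempts is active and never fresh again, so its edges leave this set
   for good. *)
pose pot (s : state) : {set U * U} := [set e in edges M |
  (s.1 e.2 == None) && ((e.1 \in s.2) || (s.1 e.1 == None))].
have -> : diffuse M k pi N
        = explore (eprob M) ask next stop fst_ fst_ k (pi, N).
  elim: k pi N {hN} => //= k IHk pi N.
  rewrite -[stop _]/(attempts M pi N == set0); case: ifP => // _.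
  by apply: bind_trials_eq => A _; apply: IHk.
have revealE X s : reveal ask next stop fst_ fst_ k s X = (iter k (step X) s).1.
  elim: k s => // k IHk s; rewrite [LHS]/= -[stop s]/(attempts M s.1 s.2 == set0).
  case: eqP => [h|_]; first by rewrite iter_step_idle.
  by rewrite iterSr -IHk.
have inv_next s (A : {set U * U}) : inv s -> A \subset ask s -> inv (next s A).
  move=> _ _ u /imsetP[[x y] hxy ->]; rewrite ffunE ifT //.
  by apply/existsP; exists x.
have ask_pot s : inv s -> ask s \subset pot s.
  by move=> _; apply/subsetP => e; rewrite !inE => /and3P[-> -> ->].
have pot_next s (A : {set U * U}) : inv s -> A \subset ask s ->
    pot (next s A) \subset pot s :\: ask s.
  move=> hs sA.
  have nextN w : next_config M s.1 A w = None -> s.1 w = None.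
    by rewrite ffunE; case: ifP.
  apply/subsetP => e; rewrite !inE => /and3P[-> /eqP/nextN -> /= h].
  have h1 : s.1 e.1 = None.
    case/orP: h => [/imsetP[a /(subsetP sA)]|/eqP/nextN //].
    by rewrite inE => /and3P[_ _ /eqP h] ->.
  rewrite h1 eqxx orbT !andbT; apply/negP => /hs.
  by rewrite h1.
rewrite (explore_reveal (eprob M) stop fst_ fst_ inv_next ask_pot pot_next k
  (E := edges M)) //.
- by apply: bind_trials_eq => X _; rewrite revealE.
- by apply/subsetP => e; rewrite inE => /andP[].
Qed.

(** The free horizon [t] lets an instance on a smaller graph be run for as long as [M]. *)
Lemma final_law_coupling S t : (#|nodes M| <= t)%N ->
  final_law M S = bind_law (trials (eprob M) (edges M))
    (fun X => dirac_law R (traj X S t).1).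
Proof.
move=> /subnKC <-; rewrite -(diffuse_stable S (t - #|nodes M|)) //.
rewrite diffuse_coupling // => u.
by rewrite inE ffunE => /negPf->.
Qed.

End Coupling.

(** * Distance to the root in the live graph *)

Section Balls.
Variables (U : finType) (X : {set U * U}) (v : U).

(* [ball i] is the set of nodes at distance less than [i] to [v] in [X], so that
   [level i] is the set of those at distance exactly [i]. *)
Definition ball i : {set U} :=
  iter i (fun A : {set U} => v |: [set e.1 | e in [set e in X | e.2 \in A]]) set0.

Definition level i : {set U} := ball i.+1 :\: ball i.

Lemma mem_ballS i u :
  (u \in ball i.+1) = (u == v) || [exists x in ball i, (u, x) \in X].
Proof.
rewrite [ball _]/= !inE; congr (_ || _); apply/imsetP/exists_inP.
  by move=> [[a x]]; rewrite inE /= => /andP[h1 h2] ->; exists x.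
by move=> [x h1 h2]; exists (u, x); rewrite ?inE ?h1 ?h2.
Qed.

Lemma ball_in i u x : x \in ball i -> (u, x) \in X -> u \in ball i.+1.
Proof.
by move=> hx hux; rewrite mem_ballS; apply/orP; right; apply/exists_inP; exists x.
Qed.

Lemma ball_subS i : ball i \subset ball i.+1.
Proof.
elim: i => [|i IHi]; first exact: sub0set.
apply/subsetP => u; rewrite mem_ballS => /predU1P[->|/exists_inP[x hx hux]].
  by rewrite mem_ballS eqxx.
exact: ball_in (subsetP IHi _ hx) hux.
Qed.

Lemma ball_mono i j : (i <= j)%N -> ball i \subset ball j.
Proof.
move=> /subnKC <-; elim: (j - i)%N => [|k IHk]; first by rewrite addn0.
by rewrite addnS (subset_trans IHk) ?ball_subS.
Qed.

Lemma level0 : level 0 = [set v].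
Proof.
apply/setP => u; rewrite in_setD mem_ballS in_set1 in_set0 /=.
by case: (u == v) => //=; apply/exists_inP => -[x]; rewrite in_set0.
Qed.

Lemma root_ball i : (0 < i)%N -> v \in ball i.
Proof. by case: i => // i _; rewrite mem_ballS eqxx. Qed.

Lemma levelP i x : x \in level i -> x \in ball i.+1.
Proof. by rewrite in_setD => /andP[]. Qed.

Lemma ball_level i : ball i.+1 = ball i :|: level i.
Proof.
by rewrite /level -{1}(setID (ball i.+1) (ball i)) (setIidPr (ball_subS i)).
Qed.

Lemma level_next i u : u \in level i.+1 -> exists2 x, x \in level i & (u, x) \in X.
Proof.
rewrite in_setD => /andP[nu]; rewrite mem_ballS => /predU1P[uv|].
  by rewrite uv root_ball in nu.
move=> /exists_inP[x hx hux]; exists x => //; rewrite in_setD hx andbT.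
by apply: contra nu => /ball_in; apply.
Qed.

Lemma mem_ball_level i x : x \in ball i -> exists2 j, (j < i)%N & x \in level j.
Proof.
elim: i => [|i IHi]; first by rewrite inE.
rewrite ball_level in_setU => /orP[/IHi[j lji hj]|hx]; last by exists i.
by exists j => //; apply: ltnW.
Qed.

(** Each ball is determined by the previous one, so growth that pauses once has stopped for good. *)
Lemma level_empty i j : level i = set0 -> (i <= j)%N -> ball j = ball i.
Proof.
move=> h /subnKC <-; elim: (j - i)%N => [|k IHk]; first by rewrite addn0.
rewrite addnS; transitivity (ball i.+1); last by rewrite ball_level h setU0.
by apply/setP => u; rewrite !mem_ballS IHk.
Qed.

Lemma ball_card i : (forall j, (j < i)%N -> level j != set0) -> (i <= #|ball i|)%N.
Proof.
elim: i => // i IHi h.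
apply: leq_ltn_trans (IHi _) _ => [j hj|]; first by apply: h; apply: ltnW.
apply: proper_card; rewrite properEneq ball_subS andbT.
by apply: contraNneq (h i (leqnn _)) => e; rewrite /level -e setDv.
Qed.

Lemma ball_closed (W : {set U}) i :
  v \in W -> (forall e, e \in X -> e.1 \in W) -> ball i \subset W.
Proof.
move=> vW XW; case: i => [|i]; first exact: sub0set.
apply/subsetP => u; rewrite mem_ballS => /predU1P[->//|/exists_inP[x _ /XW]//].
Qed.

End Balls.

Arguments ball {U} X v i : simpl never.

(** * Diffusion read level by level *)

Section Dynamics.
Variables (R : realFieldType) (U Ce : finType) (M : mim R U Ce).
Variables (L X : {set U * U}) (S : {set U}) (v : U).
(** Distances are measured in [X], while [L] selects the live edges of [M]. With a mere inclusion,
    the same levels serve the network and the instance on an RR-tuple, which may keep fewer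
    edges. *)
Hypothesis live_sub : edges M :&: L \subset X.

Local Notation pi t := ((traj M L S t).1).
Local Notation fresh t := ((traj M L S t).2).
Local Notation tried t := (attempts M (pi t) (fresh t) :&: L).

Lemma mem_tried t u x :
  ((u, x) \in tried t)
  = [&& (u, x) \in edges M :&: L, u \in fresh t & pi t x == None].
Proof.
by rewrite !inE /=; case: (_ \in L); rewrite ?andbT ?andbF //= -andbA.
Qed.

Lemma trajS_config t x : (traj M L S t.+1).1 x =
  if [exists u, (u, x) \in tried t] then
    Some (actf M x [set uc : U * cascade Ce |
            ((uc.1, x) \in tried t) && (pi t uc.1 == Some uc.2)])
  else pi t x.
Proof. by rewrite /= ffunE. Qed.

Lemma traj_fresh_active t u : u \in fresh t -> pi t u != None.
Proof.
case: t => [|t]; last exact: fresh_step.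
by rewrite inE ffunE => /negPf->.
Qed.

Lemma traj_stable t k x c : pi t x = Some c -> pi (t + k)%N x = Some c.
Proof.
move=> h; elim: k => [|k IHk]; first by rewrite addn0.
rewrite addnS trajS_config IHk ifF //.
by apply/existsP => -[u]; rewrite mem_tried IHk !andbF.
Qed.

(** Activation travels at most one edge per step and seeds are at distance at least [d], so a node
    at distance less than [j] is activated at time [d - j + 1] at the earliest. *)
Lemma inactive_ball d t j x :
  (forall y, y \in ball X v d -> cascades_at M S y = set0) ->
  x \in ball X v j -> (j + t <= d)%N -> pi t x = None.
Proof.
move=> h0; elim: t j x => [|t IHt] j x hx hd.
  rewrite ffunE h0 ?eqxx // (subsetP (ball_mono _ _ _) _ hx) //.
  by rewrite addn0 in hd.
have hd' : (j.+1 + t <= d)%N by rewrite addSnnS.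
rewrite trajS_config ifF; first exact: IHt (subsetP (ball_subS X v j) _ hx) hd'.
apply/existsP => -[u]; rewrite mem_tried => /and3P[/(subsetP live_sub) uX uf _].
have := traj_fresh_active uf; rewrite (IHt j.+1) //.
exact: ball_in hx uX.
Qed.

Variable d : nat.
Hypothesis unseeded : forall y, y \in ball X v d -> cascades_at M S y = set0.

Lemma inactive_level j t x : x \in level X v j -> (j + t < d)%N -> pi t x = None.
Proof. by move=> /levelP hx hd; apply: (inactive_ball unseeded hx). Qed.

Lemma fresh_level j t x : x \in level X v j -> (j + t)%N = d ->
  (x \in fresh t) = (pi t x != None).
Proof.
move=> hx hd; apply/idP/idP; first exact: traj_fresh_active.
case: t hd => [|t] hd; first by rewrite inE ffunE; case: ifP.
have hN : pi t x = None by apply: inactive_level hx _; rewrite -hd addnS.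
rewrite trajS_config; case: ifP => [/existsP[u hu] _|_]; last by rewrite hN.
by apply/imsetP; exists (u, x).
Qed.

(** A live in-neighbour of level [j] lies in [ball X v j.+2]; outside level [j.+1] it lies in
    [ball X v j.+1], hence is still inactive at time [t]. *)
Lemma tried_level j t u x : x \in level X v j -> (j + t.+1)%N = d ->
  ((u, x) \in tried t)
  = [&& (u, x) \in edges M :&: L, u \in level X v j.+1 & pi t u != None].
Proof.
move=> hx hd; rewrite mem_tried.
rewrite (inactive_level hx (t := t)) ?eqxx ?andbT; last by rewrite -hd addnS.
have [ux|] //= := boolP ((u, x) \in _).
have uX := subsetP live_sub _ ux.
have [ul|nul] := boolP (u \in level X v j.+1).
  by rewrite (fresh_level ul) // addSnnS.
apply/negP => /traj_fresh_active; rewrite (inactive_ball (d := d) (j := j.+1)) //.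
  by have := ball_in (levelP hx) uX; rewrite ball_level in_setU (negPf nul) orbF.
by rewrite addSnnS hd.
Qed.

Lemma active_level t :
  (forall j x, (j < d)%N -> x \in level X v j.+1 ->
     exists2 y, y \in level X v j & (x, y) \in edges M :&: L) ->
  (exists2 x, x \in level X v d & cascades_at M S x != set0) ->
  (t <= d)%N -> exists2 x, x \in level X v (d - t) & pi t x != None.
Proof.
move=> hL h0; elim: t => [|t IHt] htd.
  by case: h0 => x hx hs; exists x; rewrite ?subn0 // ffunE (negPf hs).
have [x hx ax] := IHt (ltnW htd).
rewrite -subSS subSn // in hx.
(* [rev_ord_proof] at the ordinal [t] is the bound [d - t.+1 < d]. *)
have [y hy xy] := hL (d - t.+1)%N x (rev_ord_proof (Ordinal htd)) hx.
exists y => //; rewrite trajS_config ifT //; apply/existsP; exists x.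
by rewrite (tried_level _ hy) ?subnK // xy hx ax.
Qed.

(** A node takes the state of one of its activators, all one level farther, so a property of the
    cascades seeding level [d] is passed on towards the root. [P] will be equality with [c_new],
    then its negation. *)
Lemma state_level (P : pred (cascade Ce)) j t x c :
  (forall e, e \in edges M -> (e.1 \in nodes M) && (e.2 \in nodes M)) ->
  actf_valid M -> v \in nodes M -> X \subset edges M ->
  (forall y c', y \in level X v d -> c' \in cascades_at M S y -> P c') ->
  x \in level X v j -> (j + t)%N = d -> pi t x = Some c -> P c.
Proof.
move=> hE hval vM XE h0; elim: t j x c => [|t IHt] j x c hx hd.
  have xM : x \in nodes M.
    apply: (subsetP (ball_closed j.+1 vM _)) (levelP hx) => e.
    by move=> /(subsetP XE)/hE/andP[].
  rewrite addn0 in hd; rewrite ffunE; case: ifP => // /negbT ne [<-].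
  by apply: h0 (proj1 (hval x xM) _ ne); rewrite -hd.
rewrite trajS_config; case: ifP => [|_]; last first.
  by rewrite (inactive_level hx) // -hd addnS.
move=> /existsP[u0 hu0] [<-].
pose A := [set u | (u, x) \in tried t].
(* [actf_valid] expects a total assignment; the default [c_new] is never met on [A], whose nodes are
   active. *)
pose st u : cascade Ce := odflt c_new (pi t u).
have actA u : u \in A -> pi t u = Some (st u).
  rewrite inE (tried_level _ hx) // /st => /and3P[_ _].
  by case: (pi t u).
have xM : x \in nodes M.
  by move: hu0; rewrite mem_tried inE => /and3P[/andP[/hE/andP[]]].
have -> : [set uc : U * cascade Ce |
            ((uc.1, x) \in tried t) && (pi t uc.1 == Some uc.2)]
        = [set (u, st u) | u in A].
  apply/setP => -[u c']; rewrite inE /=; apply/andP/imsetP.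
    move=> [hu /eqP hc]; have uA : u \in A by rewrite inE.
    by exists u => //; move: hc; rewrite (actA u uA) => -[->].
  by move=> [w wA [-> ->]]; rewrite (actA w wA); split; rewrite // inE in wA.
have AE u : u \in A -> (u, x) \in edges M.
  by rewrite inE mem_tried => /and3P[]; rewrite in_setI => /andP[].
have A0 : A != set0 by apply/set0Pn; exists u0; rewrite inE.
have /imsetP[u uA ->] := proj2 (hval x xM) A st A0 AE.
have ul : u \in level X v j.+1.
  by move: uA; rewrite inE (tried_level _ hx) // => /and3P[].
by apply: IHt ul _ (actA u uA); rewrite addSnnS.
Qed.

End Dynamics.

(** At time [d - j], the states of level [j] are computed from the seeds if [j = d], and otherwise
    from the live edges and the states one level farther and one step earlier. Induction on [t]
    compares the two instances. *)
Lemma traj_level_eq (R : realFieldType) (U Ce : finType) (M M' : mim R U Ce)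
    (L L' X : {set U * U}) (S S' : {set U}) (v : U) (d : nat) :
  actf M = actf M' ->
  edges M :&: L \subset X -> edges M' :&: L' \subset X ->
  (forall y, y \in ball X v d -> cascades_at M S y = set0) ->
  (forall y, y \in ball X v d -> cascades_at M' S' y = set0) ->
  (forall y, y \in level X v d -> cascades_at M S y = cascades_at M' S' y) ->
  (forall j u x, (j < d)%N -> u \in level X v j.+1 -> x \in level X v j ->
     ((u, x) \in edges M :&: L) = ((u, x) \in edges M' :&: L')) ->
  forall t j x, x \in level X v j -> (j + t)%N = d ->
  (traj M L S t).1 x = (traj M' L' S' t).1 x.
Proof.
move=> hact sL sL' h0 h0' hs hE; elim=> [|t IHt] j x hx hd.
  rewrite addn0 in hd; rewrite hd in hx.
  by rewrite !ffunE hact hs.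
have ltjd : (j < d)%N by rewrite -hd -addSnnS leq_addr.
have hT u : ((u, x) \in attempts M (traj M L S t).1 (traj M L S t).2 :&: L)
    = ((u, x) \in attempts M' (traj M' L' S' t).1 (traj M' L' S' t).2 :&: L').
  rewrite (tried_level sL h0 _ hx) // (tried_level sL' h0' _ hx) //.
  case: (boolP (u \in _)) => [ul|_]; last by rewrite !andbF.
  by rewrite (hE j) // (IHt j.+1 u) // addSnnS.
rewrite !trajS_config hact (eq_existsb hT).
rewrite (inactive_level sL h0 hx (t := t)); last by rewrite -hd addnS.
rewrite (inactive_level sL' h0' hx (t := t)); last by rewrite -hd addnS.
case: ifP => // _; congr (Some (actf _ _ _)); apply/setP => -[u c]; rewrite !inE.
have := hT u; rewrite !in_setI !in_set /= => <-.
(* Sources outside level [j.+1] succeed in neither instance, so states only have to agree on that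
   level. *)
case: (boolP (u \in level X v j.+1)) => ul.
  by rewrite (IHt j.+1 u) // addSnnS.
have : (u, x) \in attempts M (traj M L S t).1 (traj M L S t).2 :&: L = false.
  by rewrite (tried_level sL h0 u hx hd) (negPf ul) !andbF.
by rewrite !in_setI !in_set /= => ->.
Qed.

(** * The RR-tuple as a function of the live edges *)

Section RRReveal.
Variables (R : realFieldType) (U Ce : finType) (M : mim R U Ce).
Hypothesis edges_nodes :
  forall e, e \in edges M -> (e.1 \in nodes M) && (e.2 \in nodes M).

Definition rr_stop (Vt : {set U}) : bool :=
  (Vt == set0) || (Vt :&: existing_seeds M != set0).

(** The loop examines an edge only if its target is in the frontier and its source is unvisited, so
    live edges inside a level or leading away from the root are not kept. *)
Definition rr_live (X : {set U * U}) (v : U) (K : nat) : {set U * U} :=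
  [set e in X | [exists j : 'I_K,
    (e.1 \in level X v j.+1) && (e.2 \in level X v j)]].

(** One formula for both ways of returning: if level [K] is empty, then [ball X v K.+1] equals
    [ball X v K] and no frontier is added to [rr_over]. *)
Definition rr_result (X : {set U * U}) (v : U) (K : nat) : rr_tuple U :=
  RRTuple v (ball X v K.+1) (rr_live X v K) (ball X v K) (ball X v K.+1).

Definition rr_stop_at (X : {set U * U}) (v : U) (K : nat) : Prop :=
  rr_stop (level X v K) /\ forall j, (j < K)%N -> ~~ rr_stop (level X v j).

Let state : Type := (rr_tuple U * {set U})%type.
Let ask (s : state) := rr_frontier M s.1 s.2.
Let next (s : state) (A : {set U * U}) : state :=
  let Vt' := [set e.1 | e in A] in
  (RRTuple (rr_root s.1) (rr_nodes s.1 :|: Vt') (rr_edges s.1 :|: A)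
     (rr_under s.1 :|: s.2) (rr_over s.1 :|: s.2), Vt').
Let stop (s : state) := rr_stop s.2.
Let out (s : state) := if s.2 == set0 then s.1 else
  RRTuple (rr_root s.1) (rr_nodes s.1) (rr_edges s.1) (rr_under s.1)
    (rr_over s.1 :|: s.2).
Let out0 (s : state) := s.1.
Let start v : state := (RRTuple v [set v] set0 set0 set0, [set v]).

Definition rr_reveal (v : U) (X : {set U * U}) : rr_tuple U :=
  reveal ask next stop out out0 #|nodes M|.+1 (start v) X.

Lemma rr_loop_explore k (r : rr_tuple U) (Vt : {set U}) :
  rr_loop M k r Vt = explore (eprob M) ask next stop out out0 k (r, Vt).
Proof.
elim: k r Vt => // k IHk r Vt; rewrite [LHS]/= [RHS]/=.
rewrite -[stop _]/((Vt == set0) || (Vt :&: existing_seeds M != set0)) /out /=.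
case: ifP => //= _; case: ifP => // _.
by apply: bind_trials_eq => A _; apply: IHk.
Qed.

Lemma rr_law_of_coupling v :
  rr_law_of M v = bind_law (trials (eprob M) (edges M))
    (fun X => dirac_law R (rr_reveal v X)).
Proof.
rewrite /rr_law_of rr_loop_explore.
pose inv (s : state) := s.2 \subset rr_nodes s.1.
(* The target of an examined edge is visited and does not enter the next frontier, so the edge is
   not examined again. *)
pose pot (s : state) : {set U * U} := [set e in edges M |
  (e.1 \notin rr_nodes s.1) && ((e.2 \in s.2) || (e.2 \notin rr_nodes s.1))].
have inv_next s (A : {set U * U}) : inv s -> A \subset ask s -> inv (next s A).
  by move=> _ _; apply: subsetUr.
have ask_pot s : inv s -> ask s \subset pot s.
  by move=> _; apply/subsetP => e; rewrite !inE => /and3P[-> /andP[-> _] ->].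
have pot_next s (A : {set U * U}) : inv s -> A \subset ask s ->
    pot (next s A) \subset pot s :\: ask s.
  move=> /subsetP hs sA; apply/subsetP => e; rewrite in_set /= !in_setU !negb_or.
  move=> /and3P[eE /andP[e1 _] h].
  have e2 : e.2 \notin rr_nodes s.1.
    case/orP: h => [/imsetP[a /(subsetP sA)]|/andP[]//].
    by rewrite !inE => /and3P[_ /andP[h _] _] ->.
  rewrite !inE eE e1 e2 orbT /= andbT negb_and; apply/orP; right.
  by apply: contra e2; apply: hs.
apply: (explore_reveal (eprob M) stop out out0 inv_next ask_pot pot_next).
  exact: subxx.
by apply/subsetP => e; rewrite inE => /andP[].
Qed.

Lemma rr_reveal_result v (X : {set U * U}) K : X \subset edges M ->
  rr_stop_at X v K -> (K <= #|nodes M|)%N -> rr_reveal v X = rr_result X v K.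
Proof.
move=> /subsetP XE [stopK goK]; rewrite -ltnS /rr_reveal.
(* The state before pass [i]: level [i] already belongs to the nodes, but not yet to [rr_under] and
   [rr_over]. *)
pose s i : state := (RRTuple v (ball X v i.+1) (rr_live X v i) (ball X v i)
  (ball X v i), level X v i).
have -> : start v = s 0%N.
  congr (RRTuple _ _ _ _ _, _); rewrite ?level0 //.
    by rewrite ball_level level0 set0U.
  by apply/setP => e; rewrite !inE; apply/esym/negP => /andP[_ /existsP[[]]].
have sS i : next (s i) (ask (s i) :&: X) = s i.+1.
  have hA : ask (s i) :&: X
      = [set e in X | (e.1 \in level X v i.+1) && (e.2 \in level X v i)].
    apply/setP => e; rewrite in_setI [RHS]in_set.
    have -> : (e \in ask (s i)) = [&& e \in edges M,
        e.1 \in nodes M :\: ball X v i.+1 & e.2 \in level X v i].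
      by rewrite in_set.
    have [eX|_] := boolP (e \in X); last by rewrite andbF.
    have eE := XE e eX; have /andP[e1 _] := edges_nodes eE.
    rewrite eE andbT /=.
    case: (boolP (e.2 \in _)) => [e2|_]; last by rewrite !andbF.
    rewrite !in_setD e1 !andbT; apply/esym/andb_idr => _.
    by apply: ball_in (levelP e2) _; rewrite -surjective_pairing.
  have hV : [set e.1 | e in ask (s i) :&: X] = level X v i.+1.
    rewrite hA; apply/setP => u; apply/imsetP/idP.
      by move=> [e]; rewrite inE => /and3P[_ h _] ->.
    move=> hu; have [x hx ux] := level_next hu.
    by exists (u, x); rewrite // inE ux hu hx.
  rewrite /next hV hA /=; congr (RRTuple _ _ _ _ _, _);
    rewrite -?ball_level //.
  have live k e : (e \in rr_live X v k) = (e \in X) &&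
      [exists j : 'I_k, (e.1 \in level X v j.+1) && (e.2 \in level X v j)].
    by rewrite in_set.
  apply/setP => e; rewrite in_setU !live [e \in [set _ in _ | _]]in_set -andb_orr.
  congr (_ && _).
  apply/orP/existsP => [[/existsP[j hj]|h]|[j]].
  - by exists (widen_ord (leqnSn i) j).
  - by exists ord_max.
  case: (ltngtP j i) => [lji|lij|ji] h.
  - by left; apply/existsP; exists (Ordinal lji).
  - by have := ltn_ord j; rewrite ltnS leqNgt lij.
  - by right; rewrite -ji.
(* For the induction, the start is generalized to any pass [i <= K] with enough passes left to go
   beyond [K]. *)
have : (0 <= K)%N by [].
rewrite -{1}[#|nodes M|.+1]add0n; move: 0%N.
elim: #|nodes M|.+1 => [|k IHk] i leiK ltKi.
  by rewrite addn0 ltnNge leiK in ltKi.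
rewrite [LHS]/= -[stop _]/(rr_stop (level X v i)).
case: (ltngtP i K) leiK => // [ltiK|eiK] _.
  by rewrite (negPf (goK i ltiK)) sS IHk // addSnnS.
rewrite eiK stopK /out /=; case: eqP => [h|_]; last first.
  by congr RRTuple; rewrite ball_level.
have ballK : ball X v K.+1 = ball X v K by rewrite ball_level h setU0.
by rewrite /s /rr_result ballK.
Qed.

(** Otherwise levels [0] to [#|nodes M|] would all be nonempty, and the ball they form would have
    more elements than [nodes M]. *)
Lemma rr_stop_exists v (X : {set U * U}) : X \subset edges M -> v \in nodes M ->
  exists2 K, (K <= #|nodes M|)%N & rr_stop_at X v K.
Proof.
move=> /subsetP XE vM.
have [/existsP[i hi]|/existsPn noK] :=
    boolP [exists i : 'I_#|nodes M|.+1, rr_stop (level X v i)].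
  have exK : exists i, rr_stop (level X v i) by exists i.
  case: (ex_minnP exK) => K hK minK; exists K.
    by rewrite -ltnS (leq_ltn_trans (minK _ hi)).
  by split=> // j; apply: contraTN => /minK; rewrite -leqNgt.
have := @ball_card _ X v #|nodes M|.+1.
have /subset_leq_card : ball X v #|nodes M|.+1 \subset nodes M.
  by apply: ball_closed => // e /XE/edges_nodes/andP[].
move=> h /(_ _)/leq_trans -/(_ _ _ h); rewrite ltnn => h'.
have // : false.
by apply: h' => j hj; have := noK (Ordinal hj); rewrite negb_or => /andP[].
Qed.

End RRReveal.

(** * Comparison for a fixed root and a fixed live graph *)

Section Coupled.
Variables (R : realFieldType) (U Ce : finType) (M : mim R U Ce).
Hypothesis hM : mim_valid M.

Lemma edges_nodes e : e \in edges M -> (e.1 \in nodes M) && (e.2 \in nodes M).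
Proof. by case: hM => h _ _ _; apply: h. Qed.

Lemma seed_cascades (S : {set U}) y :
  (cascades_at M S y != set0) = (y \in S) || (y \in existing_seeds M).
Proof.
apply/set0Pn/orP => [[[c|]]|[yS|/bigcupP[c _ yc]]].
- by rewrite inE => yc; right; apply/bigcupP; exists c.
- by rewrite inE; left.
- by exists None; rewrite inE.
- by exists (Some c); rewrite inE.
Qed.

(** With all probabilities 1, the live edges are almost surely [rr_edges r], so the probability
    inside [g] is 0 or 1. *)
Lemma g_traj (S : {set U}) (r : rr_tuple U) :
  (forall e, e \in rr_edges r -> (e.1 \in rr_nodes r) && (e.2 \in rr_nodes r)) ->
  rr_nodes r \subset nodes M ->
  g M S r = ((traj (rr_mim M r) (rr_edges r) (S :&: rr_nodes r) #|nodes M|).1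
               (rr_root r) == Some c_new)%:R.
Proof.
move=> hE /subset_leq_card le; rewrite /g.
rewrite (final_law_coupling (M := rr_mim M r) hE _ le).
rewrite [eprob _]/= [edges _]/= trials1 bind_dirac pr_dirac.
by case: (_ == Some _); rewrite ?eqxx // eq_sym oner_eq0.
Qed.

Lemma rr_live_nodes (X : {set U * U}) v K e : e \in rr_live X v K ->
  (e.1 \in ball X v K.+1) && (e.2 \in ball X v K.+1).
Proof.
rewrite in_set => /andP[_ /existsP[j /andP[/levelP e1 /levelP e2]]].
rewrite (subsetP (ball_mono _ _ _) _ e1) ?ltnS ?ltn_ord //.
by rewrite (subsetP (ball_mono _ _ _) _ e2) // ltnS ltnW.
Qed.

Section Root.
Variables (S : {set U}) (X : {set U * U}) (v : U) (K : nat).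
Hypotheses (XE : X \subset edges M) (vM : v \in nodes M).
Hypotheses (hK : rr_stop_at M X v K) (leK : (K <= #|nodes M|)%N).

Local Notation pi t := ((traj M X S t).1).
Local Notation r := (rr_result X v K).
Local Notation pi' t := ((traj (rr_mim M r) (rr_live X v K)
                           (S :&: ball X v K.+1) t).1).

Let live : edges M :&: X \subset X. Proof. exact: subsetIr. Qed.

Let live' : edges (rr_mim M r) :&: rr_live X v K \subset X.
Proof. by apply/subsetP => e; rewrite setIid in_set => /andP[]. Qed.

Lemma rr_cascades y : y \in ball X v K.+1 ->
  cascades_at (rr_mim M r) (S :&: ball X v K.+1) y = cascades_at M S y.
Proof.
by move=> hy; apply/setP => -[c|]; rewrite [LHS]in_set [RHS]in_set /= inE hy ?andbT.
Qed.

(** Without seeds in the ball, the loop can only have stopped on an empty level; the balls have then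
    ceased to grow, and no seed has a live path to [v]. *)
Lemma root_unseeded :
  (forall y, y \in ball X v K.+1 -> cascades_at M S y = set0) ->
  pi #|nodes M| v = None /\ pi' #|nodes M| v = None.
Proof.
move=> h0; have [hstop _] := hK.
have lv0 : level X v K = set0.
  case/orP: hstop => [/eqP //|/set0Pn[y /setIP[/levelP yK yS]]].
  by have := seed_cascades S y; rewrite yS orbT h0 ?eqxx.
have ballE j : (K <= j)%N -> ball X v j = ball X v K by apply: level_empty.
have v1 : v \in ball X v 1 by rewrite root_ball.
split.
  (* As [v] is in [ball X v 1], this [d] is just large enough to keep it inactive up to time
     [#|nodes M|]. *)
  apply: (inactive_ball live (d := (#|nodes M|).+1)) v1 _ => // y.
  by rewrite ballE ?leqW // -(ballE K.+1) //; apply: h0.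
apply: (inactive_ball live' (d := (#|nodes M|).+1)) v1 _ => // y.
by rewrite ballE ?leqW // -(ballE K.+1) // => hy; rewrite rr_cascades // h0.
Qed.

Lemma first_seeded_level :
  (exists2 y, y \in ball X v K.+1 & cascades_at M S y != set0) ->
  exists d, [/\ (d <= K)%N,
    forall y, y \in ball X v d -> cascades_at M S y = set0 &
    exists2 y, y \in level X v d & cascades_at M S y != set0].
Proof.
move=> [y /mem_ball_level[i iK yi] hy].
have ex : exists i, [exists y in level X v i, cascades_at M S y != set0].
  by exists i; apply/exists_inP; exists y.
case: (ex_minnP ex) => d /exists_inP[z hz zs] dmin; exists d; split.
- by rewrite -ltnS (leq_ltn_trans (dmin i _)) //; apply/exists_inP; exists y.
- move=> x /mem_ball_level[j jd xj]; apply/eqP; apply: contraTT jd => xs.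
  by rewrite -leqNgt dmin //; apply/exists_inP; exists x.
by exists z.
Qed.

Section Seeded.
Variable d : nat.
Hypotheses (dK : (d <= K)%N)
  (h0 : forall y, y \in ball X v d -> cascades_at M S y = set0)
  (h1 : exists2 y, y \in level X v d & cascades_at M S y != set0).

Let v0 : v \in level X v 0. Proof. by rewrite level0 set11. Qed.

Lemma root_active : exists c, pi d v = Some c.
Proof.
have [|x] := active_level live h0 _ h1 (leqnn d).
  move=> j x _ /level_next[y hy xy]; exists y => //.
  by rewrite in_setI (subsetP XE _ xy).
by rewrite subnn level0 => /set1P ->; case: (pi d v) => // c _; exists c.
Qed.

(** The tuple retains all levels up to [d <= K], so the two runs agree at time [d]; the root is
    active by then and keeps its state. *)
Lemma root_eq : pi #|nodes M| v = pi' #|nodes M| v.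
Proof.
have sub x i : (i <= K.+1)%N -> x \in ball X v i -> x \in ball X v K.+1.
  by move=> iK; apply: (subsetP (ball_mono _ _ iK)).
have eq_d : pi d v = pi' d v.
  apply: (traj_level_eq _ live live' h0) v0 _ => //.
  - by move=> y hy; rewrite rr_cascades ?h0 // (sub y d) // leqW.
  - by move=> y /levelP hy; rewrite rr_cascades // (sub y d.+1).
  move=> j u x jd hu hx; rewrite setIid in_setI [RHS]in_set.
  have -> : [exists i : 'I_K, (u \in level X v i.+1) && (x \in level X v i)].
    by apply/existsP; exists (Ordinal (leq_trans jd dK)); apply/andP.
  by rewrite andbT; apply/andb_idl/(subsetP XE).
have [c hc] := root_active; have dn := leq_trans dK leK.
rewrite -(subnKC dn) (traj_stable _ hc).
by rewrite eq_d in hc; rewrite (traj_stable _ hc).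
Qed.

Lemma root_state (P : pred (cascade Ce)) :
  (forall y c, y \in level X v d -> c \in cascades_at M S y -> P c) ->
  exists2 c, pi #|nodes M| v = Some c & P c.
Proof.
move=> hP; have [c hc] := root_active; exists c.
  by rewrite -(subnKC (leq_trans dK leK)) (traj_stable _ hc).
case: hM => hE _ _ hval.
exact: (state_level live h0 hE hval vM XE hP v0 _ hc).
Qed.

End Seeded.

Lemma root_outcome :
  [/\ pi #|nodes M| v = pi' #|nodes M| v,
      S :&: ball X v K != set0 -> pi #|nodes M| v = Some c_new
    & pi #|nodes M| v = Some c_new -> S :&: ball X v K.+1 != set0].
Proof.
have [/exists_inP h1|/exists_inPn h0] :=
  boolP [exists y in ball X v K.+1, cascades_at M S y != set0]; last first.
  have h y : y \in ball X v K.+1 -> cascades_at M S y = set0.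
    by move=> /h0 /negPn /eqP.
  have [-> ->] := root_unseeded h; split=> // /set0Pn[y /setIP[yS yK]].
  have := seed_cascades S y.
  by rewrite yS h ?eqxx //; apply: (subsetP (ball_subS _ _ _)).
have [d [dK hd0 hd1]] := first_seeded_level h1.
have lvd y : y \in level X v d -> y \in ball X v K.+1.
  by move=> /levelP; apply: (subsetP (ball_mono _ _ _)).
split; first exact: root_eq dK hd0 hd1.
  move=> /set0Pn[y /setIP[yS yK]].
  (* [ball X v K] contains the seed [y] while [ball X v d] has none. As the loop did not stop at
     level [d < K], that level has no existing seed. *)
  have ltdK : (d < K)%N.
    rewrite ltnNge; apply/negP => leKd; have := seed_cascades S y.
    by rewrite yS hd0 ?eqxx //; apply: (subsetP (ball_mono _ _ leKd)).
  have [|c -> /eqP-> //] := @root_state d dK hd0 hd1 (pred1 c_new).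
  move=> z [c|] hz; rewrite in_set /= ?eqxx // => zc.
  have [_ /(_ d ltdK)] := hK; rewrite negb_or negbK => /andP[_ /eqP/setP/(_ z)].
  by rewrite in_setI hz in_set0 => /negP[]; apply/bigcupP; exists c.
(* Now [S] misses level [d], so only existing cascades are seeded there and the root cannot become
   [c_new]-active. *)
move=> hnew; apply/negP => /eqP hS.
have [|c] := @root_state d dK hd0 hd1 (predC1 c_new).
  move=> z [c|] // /lvd hz; rewrite in_set /= => zS.
  by have := in_set0 z; rewrite -hS in_setI zS hz.
by rewrite hnew => -[<-].
Qed.

End Root.

Lemma rr_reveal_bounds (S : {set U}) (X : {set U * U}) (v : U) :
  X \subset edges M -> v \in nodes M ->
  let r := rr_reveal M v X in
  [/\ g M S r = ((traj M X S #|nodes M|).1 v == Some c_new)%:R,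
      g_under R S r <= g M S r & g M S r <= g_over R S r].
Proof.
move=> XE vM r; have [K leK hK] := rr_stop_exists edges_nodes XE vM.
have rE : r = rr_result X v K := rr_reveal_result edges_nodes XE hK leK.
have [eq_pi under over] := root_outcome S XE vM hK leK.
have gE : g M S r = ((traj M X S #|nodes M|).1 v == Some c_new)%:R.
  rewrite eq_pi rE g_traj //=; first exact: rr_live_nodes.
  by apply: ball_closed => // e /(subsetP XE)/edges_nodes/andP[].
rewrite gE rE; split=> //; rewrite /g_under /g_over ler_nat /=.
  by case: (boolP (S :&: _ != set0)) => // /under ->; rewrite eqxx.
by case: eqP => // /over ->.
Qed.

(** * Averaging over the root and the live edges *)

Lemma expect_rr_law (h : rr_tuple U -> R) :
  expect (rr_law M) (fun r => #|nodes M|%:R * h r)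
  = \sum_(v in nodes M) \sum_X trials (eprob M) (edges M) X
      * h (rr_reveal M v X).
Proof.
rewrite /rr_law expect_bind [RHS]big_mkcond; apply: eq_bigr => v _.
rewrite [uniform_law _ _ _]ffunE; case: ifP => [vM|]; last by rewrite mul0r.
rewrite rr_law_of_coupling expect_bind_dirac mulr_sumr; apply: eq_bigr => X _.
have n0 : #|nodes M|%:R != 0 :> R.
  by rewrite pnatr_eq0 cards_eq0; apply/set0Pn; exists v.
by rewrite mulrCA mulKf.
Qed.

Lemma spreadE (S : {set U}) :
  spread M S = \sum_(v in nodes M) \sum_X trials (eprob M) (edges M) X
      * ((traj M X S #|nodes M|).1 v == Some c_new)%:R.
Proof.
rewrite /spread (final_law_coupling edges_nodes S (leqnn _)) expect_bind_dirac.
rewrite exchange_big; apply: eq_bigr => X _; rewrite -mulr_sumr; congr (_ * _).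
rewrite -sum1_card natr_sum big_mkcond [RHS]big_mkcond; apply: eq_bigr => v _.
by rewrite inE; case: (v \in _); case: (_ == _).
Qed.

Lemma ler_sum_trials (F G : {set U * U} -> R) :
  (forall X : {set U * U}, X \subset edges M -> F X <= G X) ->
  \sum_X trials (eprob M) (edges M) X * F X
  <= \sum_X trials (eprob M) (edges M) X * G X.
Proof.
move=> h; apply: ler_sum => X _; have [XE|/negPf nXE] := boolP (X \subset edges M).
  apply: ler_wpM2l (h X XE); apply: trials_ge0 => e.
  by case: hM => _ hp _ _ /hp /andP[/ltW -> ->].
by rewrite ffunE nXE !mul0r.
Qed.

End Coupled.

Theorem corollary1 (R : realFieldType) (U Ce : finType) (M : mim R U Ce)
    (hM : mim_valid M) (S : {set U}) (hS : S \subset nodes M) :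
  let n : R := #|nodes M|%:R in
  [/\ expect (rr_law M) (fun r => n * g_under R S r)
        <= expect (rr_law M) (fun r => n * g M S r),
      expect (rr_law M) (fun r => n * g M S r) = spread M S
    & spread M S <= expect (rr_law M) (fun r => n * g_over R S r)].
Proof.
have bounds X v := @rr_reveal_bounds _ _ _ M hM S X v.
rewrite /= spreadE // !expect_rr_law.
have gE : \sum_(v in nodes M) \sum_X trials (eprob M) (edges M) X
      * g M S (rr_reveal M v X)
  = \sum_(v in nodes M) \sum_X trials (eprob M) (edges M) X
      * ((traj M X S #|nodes M|).1 v == Some c_new)%:R.
  (* The integrands are only known to agree for [X] inside [edges M], so equality is split into two
     inequalities for [ler_sum_trials], which discards the other [X]. *)
  apply: eq_bigr => v vM; apply/eqP; rewrite eq_le.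
  by rewrite !(ler_sum_trials hM) // => X XE; have [-> _ _] := bounds X v XE vM.
rewrite -gE; split=> //; apply: ler_sum => v vM; apply: ler_sum_trials => // X XE.
  by have [] := bounds X v XE vM.
by have [] := bounds X v XE vM.
Qed.
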